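(* Let $k\ge 2$, let $H_k$ be the infinite hexagonal grid with $k$ rows, and let $(G_k,w)$ be its weighted LDS-configuration digraph. Then the following hold. (a) The digraph $G_k$ has a cycle $C$ of length $p\ge 1$ if and only if $H_k$ has a periodic locating-dominating set $S$ with a pattern $P$ of period $2p$. Furthermore, the density of $S$ in $H_k$ and the mean $\widetilde w(C)$ of the cycle $C$ (where $C$ and $S$ correspond to each other, that is, $S=S_C$) satisfy the relation $d(S,H_k)=\widetilde w(C)/(2k)$. Thus, a minimum mean cycle in $G_k$ yields a minimum-density periodic locating-dominating set of $H_k$. (b) As $H_k$ always admits an optimal (that is, minimum-density, of density $d^*(H_k)$) locating-dominating set that is periodic, we have $d^*(H_k)=\widetilde w(C^* )/(2k)$, where $C^*$ is a minimum mean cycle in $G_k$.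
   Context: **Grid.** $H_k$ is the graph with vertex set $[k]\times\mathbb Z$, $[k]=\{1,\dots,k\}$ (first coordinate = row, second coordinate = column). Its edges are $\{(i,j),(i,j+1)\}$ for all $i\in[k]$, $j\in\mathbb Z$, and $\{(i,j),(i+1,j)\}$ for all $1\le i<k$ and $j\in\mathbb Z$ with $i+j$ even. **Locating-dominating sets.** For a graph $G=(V,E)$, $N(v)$ is the set of neighbors of $v$. A set $S\subseteq V$ is a locating-dominating set (LDS) if $N(v)\cap S\ne\emptyset$ for every $v\in V\setminus S$, and $N(u)\cap S\ne N(v)\cap S$ for all distinct $u,v\in V\setminus S$. **Density.** For an integer $r\ge1$, $N_r(v)=\{u\in V: 0<\mathrm{dist}(u,v)\le r\}$. For $S\subseteq V$, $d_v(S,G)=\limsup_{r\to\infty}|N_r(v)\cap S|/|N_r(v)|$ and $d(S,G)=\inf_{v\in V}d_v(S,G)$. The minimum density is $d^*(G)=\inf\{d(S,G): S\text{ is an LDS of }G\}$. **Periodicity.** An LDS $S$ of $H_k$ is periodic with a pattern of period $p\ge1$ if $H_k$ can be partitioned into blocks of $p$ consecutive columns on which $S$ is identical, i.e. for all $(i,j)$: $(i,j)\in S\iff(i,j+p)\in S$; a pattern is one such block together with the vertices of $S$ in it. The period $p$ need not be the smallest one. $S$ is periodic if this holds for some $p\ge 1$. **Bars and barcodes.** An $\ell$-bar ($\ell\ge4$) of $H_k$ is the subgraph $R$ induced by $\ell$ consecutive columns. A set $B\subseteq V(R)$ is a barcode of $R$ if, for the set $I$ of vertices of $R$ lying in all columns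 of $R$ except the first and the last, (i) every $v\in I\setminus B$ satisfies $N(v)\cap B\neq\emptyset$, and (ii) every two distinct $u,v\in I\setminus B$ satisfy $N(u)\cap B\ne N(v)\cap B$. **Configuration digraph.** For sets $X_1,\dots,X_n\subseteq[k]\times\{1,2\}$, let $X_1X_2\cdots X_n$ denote the subset of $[k]\times\{1,\dots,2n\}$ obtained by placing $X_m$ in columns $2m-1,2m$, i.e. $\{(i,c+2m-2): 1\le m\le n,\ (i,c)\in X_m\}$. The vertices of $G_k$ are the barcodes $XY$ of the $4$-bar on columns $1,\dots,4$ of $H_k$. There is an arc from $XY$ to $X'Y'$ if and only if $Y=X'$ (the last two columns of the first barcode are identical to the first two columns of the second) and $XYY'$ is a barcode of the $6$-bar on columns $1,\dots,6$; loops are allowed. The weight of this arc is $w=|Y'|$, the number of selected vertices in the last two columns of the second barcode. **Cycles.** A cycle in $G_k$ means a directed cycle, represented by its sequence of vertices $C=(B_1,\dots,B_p)$ without repetitions, with an arc from $B_m$ to $B_{m+1}$ for each $m$ (indices modulo $p$). Its length is its number $p\ge1$ of arcs; a loop is a cycle of length $1$. Its weight $w(C)$ is the sum of the weights of its arcs and its mean is $\widetilde w(C)=w(C)/p$. A minimum mean cycle is a cycle of minimum mean. **Correspondence.** For a cycle $C=(B_1,\dots,B_p)$ with $B_m=X_mX_{m+1}$ (indices modulo $p$), $S_C\subseteq V(H_k)$ is the set obtained by repeating $X_1X_2\cdots X_p$ side by side, that is, placing $X_m$ (index taken modulo $p$ in $\{1,\dots,p\}$) in columns $2m-1,2m$ for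 every $m\in\mathbb Z$.
   Formalization: As cycles have no repeated vertices, the equivalence in (a) fails for large p (S=V has every period 2p); it is proved for each p with closed walks in place of cycles, and for cycles with those S of period 2p whose p windows X_1X_2,...,X_pX_1 are distinct. *)

(* Defs.v *)
From HB Require Import structures.
From mathcomp Require Import all_boot all_order all_algebra.
From mathcomp Require Import finmap.
From mathcomp Require Import all_classical all_reals all_analysis.

Set Implicit Arguments.
Unset Strict Implicit.
Unset Printing Implicit Defensive.
Import Order.TTheory GRing.Theory Num.Theory.
Local Open Scope classical_set_scope.
Local Open Scope ring_scope.

Definition neigh (V : choiceType) (adj : rel V) (v : V) : set V :=
  [set u | adj v u].

Definition is_LDS (V : choiceType) (adj : rel V) (S : set V) : Prop :=
  (forall v, ~ S v -> neigh adj v `&` S !=set0) /\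
  (forall u v, u <> v -> ~ S u -> ~ S v ->
     neigh adj u `&` S <> neigh adj v `&` S).

Definition walk (V : choiceType) (adj : rel V) (u v : V) (n : nat) : Prop :=
  exists s : seq V, [/\ path adj u s, last u s = v & size s = n].

(* Relational because the distance between two vertices in different
   components is not a natural number. *)
Definition is_dist (V : choiceType) (adj : rel V) (u v : V) (n : nat) : Prop :=
  walk adj u v n /\ (forall m, walk adj u v m -> (n <= m)%N).

Definition pball (V : choiceType) (adj : rel V) (r : nat) (v : V) : set V :=
  [set u | exists n, is_dist adj u v n /\ (0 < n <= r)%N].

(* [fset_set A] is [A] as a finite set only when [A] is finite; this is the case
   for the punctured balls of a locally finite graph. *)
Definition card_ratio (R : realType) (V : choiceType) (adj : rel V) (S : set V)
    (v : V) (r : nat) : R :=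
  (#|` fset_set (pball adj r v `&` S)|)%:R / (#|` fset_set (pball adj r v)|)%:R.

Definition vdensity (R : realType) (V : choiceType) (adj : rel V) (S : set V)
    (v : V) : \bar R :=
  limn_esup (fun r => (card_ratio R adj S v r)%:E).

Definition density (R : realType) (V : choiceType) (adj : rel V) (S : set V)
    : \bar R :=
  ereal_inf [set vdensity R adj S v | v in [set: V]].

Definition min_density (R : realType) (V : choiceType) (adj : rel V) : \bar R :=
  ereal_inf [set density R adj S | S in [set S | is_LDS adj S]].

Definition hvertex (k : nat) : choiceType := ('I_k * int)%type.

(* Rows are numbered from 1 mathematically, so row [i : 'I_k] is row [i.+1];
   this matters for the parity condition on vertical edges. *)
Definition hedge (k : nat) (u v : hvertex k) : bool :=
  ((u.1 == v.1) && (v.2 == u.2 + 1)) ||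
  [&& (v.1 : nat) == u.1.+1, v.2 == u.2 & (2 %| (u.1.+1)%:Z + u.2)%Z].

Definition hadj (k : nat) : rel (hvertex k) :=
  fun u v => hedge u v || hedge v u.

Definition has_period (k : nat) (S : set (hvertex k)) (p : nat) : Prop :=
  (0 < p)%N /\ forall (i : 'I_k) (j : int), S (i, j) <-> S (i, j + p%:Z).

Definition is_periodic (k : nat) (S : set (hvertex k)) : Prop :=
  exists p, has_period S p.

(* The bar made of columns a, ..., a + l - 1, and its vertices that lie neither
   in the first nor in the last column. *)
Definition bar (k : nat) (a : int) (l : nat) : set (hvertex k) :=
  [set v | a <= v.2 < a + l%:Z].
Definition bar_inner (k : nat) (a : int) (l : nat) : set (hvertex k) :=
  [set v | a < v.2 < a + l%:Z - 1].

(* For an inner vertex, all neighbours in the grid belong to the bar. *)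
Definition is_barcode (k : nat) (a : int) (l : nat) (B : set (hvertex k))
    : Prop :=
  [/\ B `<=` @bar k a l,
      forall v, @bar_inner k a l v -> ~ B v -> neigh (@hadj k) v `&` B !=set0
    & forall u v, @bar_inner k a l u -> @bar_inner k a l v -> u <> v ->
        ~ B u -> ~ B v -> neigh (@hadj k) u `&` B <> neigh (@hadj k) v `&` B].

(* Subsets of [k] x {1,2}; column [c : 'I_2] stands for column [c.+1]. *)
Definition two_cols (k : nat) : finType := {set 'I_k * 'I_2}.

(* X_1 X_2 ... X_n, with X_m (that is, [nth set0 Xs m.-1]) in columns 2m-1, 2m. *)
Definition juxtapose (k : nat) (Xs : seq (two_cols k)) : set (hvertex k) :=
  [set v | exists (m : nat) (c : 'I_2),
     [/\ (m < size Xs)%N, (v.1, c) \in (nth finset.set0 Xs m : {set _})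
       & v.2 = (c.+1 + 2 * m)%N%:Z]].

(* The pair (X, Y) encodes the subset XY of [k] x {1,...,4}. *)
Definition config (k : nat) : finType := (two_cols k * two_cols k)%type.

Definition is_config (k : nat) (B : config k) : Prop :=
  is_barcode 1 4 (juxtapose [:: B.1; B.2]).

Definition arc (k : nat) : rel (config k) := fun B B' =>
  `[< [/\ is_config B, is_config B', B.2 = B'.1
        & is_barcode 1 6 (juxtapose [:: B.1; B.2; B'.2])] >].

Definition arc_weight (k : nat) (B B' : config k) : nat :=
  #|(B'.2 : {set 'I_k * 'I_2})|.

(* Closed walks may repeat vertices, cycles may not.  [cycle e [:: x]] is
   [e x x], so loops are included. *)
Definition is_closed_walk (k : nat) (C : seq (config k)) : Prop :=
  (0 < size C)%N /\ path.cycle (@arc k) C.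

Definition is_cycle (k : nat) (C : seq (config k)) : Prop :=
  is_closed_walk C /\ uniq C.

(* [zip C (rot 1 C)] lists the arcs (B_1,B_2), ..., (B_p,B_1). *)
Definition cycle_weight (k : nat) (C : seq (config k)) : nat :=
  (\sum_(e <- zip C (rot 1 C)) arc_weight e.1 e.2)%N.

Definition cycle_mean (R : realType) (k : nat) (C : seq (config k)) : R :=
  (cycle_weight C)%:R / (size C)%:R.

Definition is_min_mean_cycle (R : realType) (k : nat) (C : seq (config k))
    : Prop :=
  is_cycle C /\
  forall C' : seq (config k), is_cycle C' -> cycle_mean R C <= cycle_mean R C'.

(* With m counted from 0, X_m (the first component of B_m, m modulo p) is placed
   in columns 2m+1, 2m+2, for every integer m. *)
Definition set_of_cycle (k : nat) (C : seq (config k)) : set (hvertex k) :=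
  [set v | exists (m : int) (c : 'I_2),
     (v.1, c) \in
       ((nth (finset.set0, finset.set0) C `|(m %% (size C)%:Z)%Z|%N).1 : {set _})
     /\ v.2 = (c.+1)%:Z + 2 * m].

(* The trace of S on columns 2m+1, 2m+2. *)
Definition trace2 (k : nat) (S : set (hvertex k)) (m : nat) : two_cols k :=
  [set x : 'I_k * 'I_2 | `[< S (x.1, (x.2.+1)%:Z + 2 * m%:Z) >]]%SET.

(* The p four-column windows X_1X_2, X_2X_3, ..., X_pX_{p+1} of S. *)
Definition configs_of (k : nat) (S : set (hvertex k)) (p : nat)
    : seq (config k) :=
  [seq (trace2 S m, trace2 S m.+1) | m <- iota 0 p].

(* Main.v *)
(** Being a locating-dominating set is a local condition: two vertices with the
    same nonempty trace of neighbours lie within three consecutive columns, so S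
    is an LDS iff every six-column window at an even offset is a barcode, i.e.
    iff the sequence of its four-column windows is a bi-infinite walk in G_k.
    Periodic LDSs thus correspond to closed walks.  A punctured ball of radius r
    lies between full bars of 2(r-3k)+1 and 2r+1 columns, hence the density of S
    is governed by the number of its vertices in long bars.  For a periodic S
    this number is linear in the length up to O(1).  For an arbitrary LDS, a long
    walk in G_k splits into simple cycles and a remainder of bounded length, so
    the number of vertices is at least (minimum mean) * (length / 2) - O(1). *)

Require Import Defs.
From HB Require Import structures.
From mathcomp Require Import all_boot all_order all_algebra.
From mathcomp Require Import finmap.
From mathcomp Require Import all_classical all_reals all_analysis.
From mathcomp Require Import zify ring lra.
Import Order.TTheory GRing.Theory Num.Theory.
Local Open Scope classical_set_scope.
Local Open Scope ring_scope.

(** * Walks in weighted digraphs *)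

(** By induction from the right end: if the tail is already duplicate-free, the head recurs in it,
    and the stretch up to that recurrence is a simple cycle. Both ends of the stretch being [y],
    cutting it out leaves a walk. *)
Lemma uniq_cycle_split (T : eqType) (e : rel T) (t : seq T) :
  sorted e t -> ~~ uniq t ->
  exists t1 y c t2, [/\ t = t1 ++ (y :: c) ++ y :: t2, uniq (y :: c),
    path.cycle e (y :: c) & sorted e (t1 ++ y :: t2)].
Proof.
elim: t => // x t IH /= xt.
have [ut|/IH {}IH _] := boolP (uniq t); last first.
  have [t1 [y [c [t2 [tE uc cc st]]]]] := IH (path_sorted xt).
  exists (x :: t1), y, c, t2; split; rewrite ?tE //.
  by move: xt st; rewrite tE; case: (t1) => [|z t1'] /= /andP[-> _] ->.
rewrite andbT negbK => xs; case/splitPr: xs xt ut => t1 t2.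
rewrite cat_path cat_uniq /= => /and3P[pt1 l1 pt2].
move=> /and3P[u1 /norP[xt1 _] _].
by exists [::], x, t1, t2; split; rewrite //= ?xt1 ?u1 // rcons_path pt1 l1.
Qed.

(** Simple cycles are cut out one at a time, each paying at least [mu] per vertex. What survives has
    no repetition, hence at most [#|T|] vertices, and for it the left-hand side is nonpositive. *)
Lemma walk_weight_ge (R : realFieldType) (T : finType) (e : rel T)
    (f : T -> nat) (mu : R) (t : seq T) : 0 <= mu ->
  (forall c, (0 < size c)%N -> path.cycle e c -> uniq c ->
     mu * (size c)%:R <= (\sum_(x <- c) f x)%N%:R) ->
  sorted e t -> mu * ((size t)%:R - #|T|%:R) <= (\sum_(x <- t) f x)%N%:R.
Proof.
move=> mu0 mumin; have [n] := ubnP (size t); elim: n t => // n IH t tn st.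
have [ut|nut] := boolP (uniq t).
  apply: le_trans (ler0n _ _); apply: mulr_ge0_le0 => //.
  by rewrite subr_le0 ler_nat -(card_uniqP ut) max_card.
have [t1 [y [c [t2 [tE uc cc st']]]]] := uniq_cycle_split _ _ _ st nut.
have -> : (\sum_(x <- t) f x =
    \sum_(x <- t1 ++ y :: t2) f x + \sum_(x <- y :: c) f x)%N.
  by rewrite tE !big_cat /=; lia.
have sE : size t = (size (t1 ++ y :: t2) + size (y :: c))%N.
  by rewrite tE !size_cat /=; lia.
rewrite sE !natrD -addrAC mulrDr lerD ?mumin //.
by apply: IH => //; move: tn; rewrite sE /=; lia.
Qed.

(** * Locality of the LDS condition *)

(** Only even shifts are used, since the position of the vertical edges depends on the parity of the
    column. *)
Definition hshift (k : nat) (S : set (hvertex k)) (m : int) : set (hvertex k) :=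
  [set v | S (v.1, v.2 + 2 * m)].

Definition tracez (k : nat) (S : set (hvertex k)) (m : int) : two_cols k :=
  [set x : 'I_k * 'I_2 | `[< S (x.1, (x.2.+1)%:Z + 2 * m) >]]%SET.

Lemma juxtapose_tracez (k : nat) (S : set (hvertex k)) (m : int) (n : nat) :
  juxtapose [seq tracez k S (m + i%:Z) | i <- iota 0 n] =
  @bar k 1 (2 * n) `&` hshift k S m.
Proof.
apply/seteqP; split=> [[i j]|[i [j|j]]]; rewrite /juxtapose /bar /hshift /=.
- move=> [t [c [tn]]]; rewrite size_map size_iota in tn.
  rewrite (nth_map 0%N) ?size_iota // nth_iota // inE /= => /asboolP Sij ->.
  have := ltn_ord c; split; first by lia.
  by congr (S (i, _)): Sij; lia.
(* Columns are numbered from 1, so column [j] sits in block [(j - 1) / 2] at offset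
   [(j - 1) mod 2]. *)
- move=> [jn Sij]; exists (j.-1)./2, (Ordinal (ltn_pmod j.-1 (isT : 0 < 2)%N)).
  have tn : (j.-1./2 < n)%N by lia.
  rewrite size_map size_iota (nth_map 0%N) ?size_iota // nth_iota //.
  rewrite inE /=; split=> //; last by rewrite modn2; lia.
  by apply/asboolP; congr (S (i, _)): Sij; rewrite modn2; lia.
- by move=> [jn _]; lia.
Qed.

Lemma hadj_sym (k : nat) : symmetric (@hadj k).
Proof. by move=> u v; rewrite /hadj orbC. Qed.

Lemma hadj_shift (k : nat) (u v : hvertex k) (m : int) :
  hadj (u.1, u.2 + 2 * m) (v.1, v.2 + 2 * m) = hadj u v.
Proof.
have eE (x y : hvertex k) : hedge (x.1, x.2 + 2 * m) (y.1, y.2 + 2 * m) = hedge x y.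
  by rewrite /hedge /=; congr (_ && _ || [&& _, _ & _]); lia.
by rewrite /hadj !eE.
Qed.

Lemma hadj_cols (k : nat) (u v : hvertex k) :
  hadj u v -> u.2 - 1 <= v.2 <= u.2 + 1.
Proof.
by move=> /orP[] /orP[/andP[_ /eqP]|/and3P[_ /eqP]]; lia.
Qed.

Lemma neigh_bar (k : nat) (a : int) (l : nat) (S : set (hvertex k))
    (v : hvertex k) : @bar_inner k a l v ->
  neigh (@hadj k) v `&` (@bar k a l `&` S) = neigh (@hadj k) v `&` S.
Proof.
move=> vI; rewrite setIA; apply/seteqP; split=> [w [[]]|w [vw Sw]] //.
split=> //; split=> //; move: vI (hadj_cols _ _ _ vw).
by rewrite /bar_inner /bar /=; lia.
Qed.

Lemma bar_innerW (k : nat) (a : int) (l : nat) : @bar_inner k a l `<=` @bar k a l.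
Proof. by move=> v; rewrite /bar_inner /bar /=; lia. Qed.

(** An edge changes the column by at most one, so an inner vertex sees the same neighbours in [S]
    and in its restriction to the bar. *)
Lemma is_barcode_bar (k : nat) (a : int) (l : nat) (S : set (hvertex k)) :
  is_barcode a l (@bar k a l `&` S) <->
  (forall v, @bar_inner k a l v -> ~ S v -> neigh (@hadj k) v `&` S !=set0) /\
  (forall u v, @bar_inner k a l u -> @bar_inner k a l v -> u <> v ->
     ~ S u -> ~ S v -> neigh (@hadj k) u `&` S <> neigh (@hadj k) v `&` S).
Proof.
have nS v : @bar_inner k a l v -> (~ (@bar k a l `&` S) v) = (~ S v).
  move=> /(bar_innerW k a l v) vI; apply/propext; split; apply: contra_not => //.
  by case.
split=> [[_ dom sep]|[dom sep]]; split.
- by move=> v vI Sv; rewrite -(neigh_bar _ _ _ _ _ vI); apply: dom; rewrite ?nS.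
- move=> u v uI vI uv Su Sv.
  rewrite -(neigh_bar _ _ _ _ _ uI) -(neigh_bar _ _ _ _ _ vI).
  by apply: sep; rewrite ?nS.
- exact: subIsetl.
- by move=> v vI; rewrite nS // neigh_bar //; apply: dom.
- by move=> u v uI vI uv; rewrite !nS // !neigh_bar //; apply: sep.
Qed.

Lemma is_LDS_hshift (k : nat) (S : set (hvertex k)) (m : int) :
  is_LDS (@hadj k) S -> is_LDS (@hadj k) (hshift k S m).
Proof.
pose sh (n : int) (v : hvertex k) : hvertex k := (v.1, v.2 + 2 * n).
have shK n v : sh n (sh (- n) v) = v by case: v => i j; congr (i, _) => /=; lia.
have Kn (v w : hvertex k) : (neigh (@hadj k) v `&` hshift k S m) w =
    (neigh (@hadj k) (sh m v) `&` S) (sh m w).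
  by rewrite /neigh /setI /= /sh hadj_shift.
move=> [dom sep]; split=> [v Sv|u v uv Su Sv uvE].
  have [w vw] := dom (sh m v) Sv.
  by exists (sh (- m) w); rewrite Kn shK.
apply: (sep (sh m u) (sh m v)) => //.
  move: u v uv {Su Sv uvE} => [i j] [i' j'] uv [] ii' jj'.
  by apply: uv; congr (_, _) => //; lia.
by apply/funext => w; rewrite -(shK m w) -!Kn uvE.
Qed.

Lemma is_LDS_barcode (k : nat) (S : set (hvertex k)) (m a : int) (l : nat) :
  is_LDS (@hadj k) S -> is_barcode a l (@bar k a l `&` hshift k S m).
Proof.
move=> /(is_LDS_hshift _ _ m)[dom sep]; apply/is_barcode_bar.
by split=> [v _|u v _ _]; [exact: dom|exact: sep].
Qed.

(* Two vertices with a common neighbour lie in three consecutive columns, hence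
   among the four inner columns of some six-column window. *)
Lemma barcode6_LDS (k : nat) (S : set (hvertex k)) :
  (forall m, is_barcode 1 6 (@bar k 1 6 `&` hshift k S m)) ->
  is_LDS (@hadj k) S.
Proof.
pose sh (n : int) (v : hvertex k) : hvertex k := (v.1, v.2 + 2 * n).
have shK n v : sh n (sh (- n) v) = v by case: v => i j; congr (i, _) => /=; lia.
have Kn m (v w : hvertex k) : (neigh (@hadj k) v `&` hshift k S m) w =
    (neigh (@hadj k) (sh m v) `&` S) (sh m w).
  by rewrite /neigh /setI /= /sh hadj_shift.
move=> bc.
(* The inner columns of a six-bar are 2 to 5. Bringing a vertex to column 2 or 3 leaves room for two
   more columns on its right. *)
have win (j : int) : exists m : int, 2 <= j - 2 * m <= 3.
  exists ((j - 2) %/ 2)%Z; have := divz_eq (j - 2) 2.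
  have := modz_ge0 (j - 2) (isT : 2 != 0 :> int).
  by have := ltz_pmod (j - 2) (isT : 0 < 2 :> int); lia.
have dom v : ~ S v -> neigh (@hadj k) v `&` S !=set0.
  move=> Sv; have [m vm] := win v.2.
  have /is_barcode_bar[/(_ (sh (- m) v)) dom _] := bc m.
  have [||w] := dom; first by move: vm; rewrite /bar_inner /sh /=; lia.
    by rewrite -{1}(shK m v) in Sv.
  by rewrite Kn shK; exists (sh m w).
split=> // u v.
wlog: u v / u.2 <= v.2 => [H uv Su Sv uvE|].
  by have [uv2|/ltW vu2] := leP u.2 v.2; [apply: (H u v)|apply: (H v u) => // ?; apply: uv].
move=> uv2 uv Su Sv uvE.
(* The common neighbour comes from domination: [w] dominates [v], and equal traces make it a
   neighbour of [u] too. *)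
have [w vw] := dom v Sv; have uw := vw; rewrite -uvE in uw.
have [m um] := win u.2; have /is_barcode_bar[_ sep] := bc m.
move: (hadj_cols _ _ _ vw.1) (hadj_cols _ _ _ uw.1) => vwc uwc.
rewrite /= in um uv2 vwc uwc.
apply: (sep (sh (- m) u) (sh (- m) v)); rewrite /bar_inner /sh /=; try lia.
- by move=> /(congr1 (sh m)); rewrite !shK.
- by rewrite -[X in S X](shK m u) in Su.
- by rewrite -[X in S X](shK m v) in Sv.
- by apply/funext => x; rewrite !Kn !shK uvE.
Qed.

(** * Cycles and periodic sets *)

Definition window (k : nat) (S : set (hvertex k)) (m : int) : config k :=
  (tracez k S m, tracez k S (m + 1)).

Lemma arc_windowP (k : nat) (S : set (hvertex k)) (m : int) :
  Defs.arc (window k S m) (window k S (m + 1)) <->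
  is_barcode 1 4 (@bar k 1 4 `&` hshift k S m) /\
  is_barcode 1 4 (@bar k 1 4 `&` hshift k S (m + 1)) /\
  is_barcode 1 6 (@bar k 1 6 `&` hshift k S m).
Proof.
have J4 n : juxtapose [:: tracez k S n; tracez k S (n + 1)] =
    @bar k 1 4 `&` hshift k S n.
  by rewrite -(juxtapose_tracez k S n 2) /= addr0.
have J6 : juxtapose [:: tracez k S m; tracez k S (m + 1); tracez k S (m + 1 + 1)] =
    @bar k 1 6 `&` hshift k S m.
  by rewrite -(juxtapose_tracez k S m 3) /= addr0 -addrA.
rewrite /Defs.arc /is_config /window /= !J4 J6.
by split=> [/asboolP[]//|[? [? ?]]]; apply/asboolP; split.
Qed.

Lemma is_LDS_arcP (k : nat) (S : set (hvertex k)) :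
  is_LDS (@hadj k) S <->
  forall m, Defs.arc (window k S m) (window k S (m + 1)).
Proof.
split=> [lds m|arcS]; first by apply/arc_windowP; split; [|split]; exact: is_LDS_barcode.
by apply: barcode6_LDS => m; have /arc_windowP[_ []] := arcS m.
Qed.

Lemma cycle_nthP (T : Type) (x0 : T) (e : rel T) (s : seq T) :
  path.cycle e s <->
  forall i, (i < size s)%N -> e (nth x0 s i) (nth x0 s (i.+1 %% size s)%N).
Proof.
case: s => [|x s] //=; split=> [/(pathP x0) es i|es].
  rewrite ltnS => le_is; have := es i; rewrite size_rcons ltnS => /(_ le_is).
  rewrite nth_rcons -rcons_cons nth_rcons /= ltnS le_is.
  have [lt_is|] := ltnP i (size s); first by rewrite modn_small //= ltnS.
  by move=> ge_is; have -> : i = size s; [lia|rewrite eqxx modnn].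
apply/(pathP x0) => i; rewrite size_rcons => le_is; have := es i le_is.
rewrite nth_rcons -rcons_cons nth_rcons /= le_is.
have [lt_is|ge_is] := ltnP i (size s); first by rewrite modn_small //= ltnS.
by have -> : i = size s; [lia|rewrite eqxx modnn].
Qed.

Lemma periodicz (T : Type) (f : int -> T) (p : int) :
  (forall m, f (m + p) = f m) -> forall m n, f (m + p * n) = f m.
Proof.
move=> fp m; elim/int_ind => [|n IH|n IH].
- by rewrite mulr0 addr0.
- by rewrite -IH -(fp (m + p * n%:Z)); congr f; lia.
- by rewrite -IH -(fp (m + p * - n.+1%:Z)); congr f; lia.
Qed.

Lemma periodicz_mod (T : Type) (f : int -> T) (p : int) :
  (forall m, f (m + p) = f m) -> forall m, f (m %% p)%Z = f m.
Proof.
move=> /periodicz fp m; rewrite -(fp _ (m %/ p)%Z) addrC mulrC.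
by rewrite -divz_eq.
Qed.

Lemma col_split (j : int) : exists (m : int) (c : 'I_2), j = (c.+1)%:Z + 2 * m.
Proof.
have ge0 := modz_ge0 (j - 1) (isT : 2 != 0 :> int).
have lt2 := ltz_pmod (j - 1) (isT : 0 < 2 :> int).
have eqj := divz_eq (j - 1) 2.
have c2 : (`|((j - 1) %% 2)%Z| < 2)%N by lia.
by exists ((j - 1) %/ 2)%Z, (Ordinal c2) => /=; lia.
Qed.

(** The index is the one of [set_of_cycle], so the two agree by definition; it makes [C] a
    bi-infinite periodic sequence. *)
Definition nthz (k : nat) (C : seq (config k)) (m : int) : config k :=
  nth (finset.set0, finset.set0) C `|(m %% (size C)%:Z)%Z|%N.

Lemma nthz_periodic (k : nat) (C : seq (config k)) (m : int) :
  nthz k C (m + (size C)%:Z) = nthz k C m.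
Proof. by rewrite /nthz modzDr. Qed.

Lemma nthz_nat (k : nat) (C : seq (config k)) (i : nat) :
  nthz k C i%:Z = nth (finset.set0, finset.set0) C (i %% size C)%N.
Proof. by rewrite /nthz modz_nat. Qed.

Lemma tracez_set_of_cycle (k : nat) (C : seq (config k)) (m : int) :
  tracez k (set_of_cycle C) m = (nthz k C m).1.
Proof.
apply/finset.setP => -[i c]; rewrite inE /=; apply/asboolP/idP.
  move=> [m' [c' [/=]]] + cE; have mE : m = m'.
    by have := ltn_ord c; have := ltn_ord c'; lia.
  by rewrite mE in cE *; have -> : c' = c by apply/val_inj => /=; lia.
by exists m, c.
Qed.

Lemma set_of_cycle_period (k : nat) (C : seq (config k)) : (0 < size C)%N ->
  has_period (set_of_cycle C) (2 * size C).
Proof.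
move=> C0; split; first by rewrite muln_gt0.
move=> i j; have [m [c ->]] := col_split j.
have E n : set_of_cycle C (i, (c.+1)%:Z + 2 * n) <-> (i, c) \in ((nthz k C n).1 : {set _}).
  by rewrite -tracez_set_of_cycle inE; split=> /asboolP.
rewrite E; have -> : c.+1%:Z + 2 * m + (2 * size C)%N%:Z = c.+1%:Z + 2 * (m + (size C)%:Z).
  by lia.
by rewrite E nthz_periodic.
Qed.

Lemma arc_nthz (k : nat) (C : seq (config k)) (m : int) : is_closed_walk C ->
  Defs.arc (nthz k C m) (nthz k C (m + 1)).
Proof.
move=> [C0 /(cycle_nthP _ (finset.set0, finset.set0)) arcC].
rewrite -(periodicz_mod _ _ _ (nthz_periodic k C) m).
(* Both indices are moved by the same multiple of the length; the second may then equal the length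
   itself, which is the closing arc of the cycle. *)
have mE : (m %% (size C)%:Z)%Z + 1 =
    m + 1 + (size C)%:Z * (- (m %/ (size C)%:Z)%Z).
  by have := divz_eq m (size C)%:Z; lia.
rewrite -(periodicz _ _ _ (nthz_periodic k C) (m + 1) (- (m %/ (size C)%:Z)%Z)) -mE.
have : 0 <= (m %% (size C)%:Z)%Z by rewrite modz_ge0 //; lia.
have : (m %% (size C)%:Z)%Z < (size C)%:Z by rewrite ltz_pmod.
case: (m %% _)%Z => // i lt_i _; rewrite -PoszD addn1 !nthz_nat (modn_small lt_i).
exact: arcC.
Qed.

(** [set_of_cycle] records only first components; the condition [B.2 = B'.1] on arcs recovers the
    second ones. *)
Lemma window_set_of_cycle (k : nat) (C : seq (config k)) (m : int) :
  is_closed_walk C -> window k (set_of_cycle C) m = nthz k C m.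
Proof.
move=> cw; rewrite /window !tracez_set_of_cycle.
have /asboolP[_ _ <- _] := arc_nthz k C m cw; exact: esym (surjective_pairing _).
Qed.

Lemma set_of_cycle_LDS (k : nat) (C : seq (config k)) :
  is_closed_walk C -> is_LDS (@hadj k) (set_of_cycle C).
Proof.
by move=> cw; apply/is_LDS_arcP => m; rewrite !window_set_of_cycle //; exact: arc_nthz.
Qed.

Lemma configs_ofE (k : nat) (S : set (hvertex k)) (p : nat) :
  configs_of S p = [seq window k S m%:Z | m <- iota 0 p].
Proof.
apply: eq_map => m; rewrite /window.
by have -> : m%:Z + 1 = m.+1%:Z by lia.
Qed.

(** With [configs_ofK] this makes closed walks of length p and LDSs of period 2p correspond
    bijectively, so that a cycle is singled out by the distinctness of the windows. *)
Lemma set_of_cycleK (k : nat) (C : seq (config k)) : is_closed_walk C ->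
  configs_of (set_of_cycle C) (size C) = C.
Proof.
move=> cw; rewrite configs_ofE -[RHS](mkseq_nth (finset.set0, finset.set0)).
apply/eq_in_map => i; rewrite mem_iota add0n => /andP[_ ltiC].
by rewrite window_set_of_cycle // nthz_nat modn_small.
Qed.

Lemma tracez_periodic (k : nat) (S : set (hvertex k)) (p : nat) (m : int) :
  has_period S (2 * p) -> tracez k S (m + p%:Z) = tracez k S m.
Proof.
move=> [_ Sp]; apply/finset.setP => -[i c]; rewrite !inE /=.
apply/asbool_equiv_eq; rewrite (Sp i (c.+1%:Z + 2 * m)).
by have -> : c.+1%:Z + 2 * (m + p%:Z) = c.+1%:Z + 2 * m + (2 * p)%N%:Z by lia.
Qed.

Lemma nthz_configs_of (k : nat) (S : set (hvertex k)) (p : nat) (m : int) :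
  has_period S (2 * p) -> nthz k (configs_of S p) m = window k S m.
Proof.
move=> Sp; have p0 : (0 < p)%N by case: Sp => + _; rewrite muln_gt0.
have Wp n : window k S (n + p%:Z) = window k S n.
  by rewrite /window addrAC !(tracez_periodic k S p _ Sp).
rewrite -(periodicz_mod _ _ _ Wp m) /nthz configs_ofE size_map size_iota.
have : 0 <= (m %% p%:Z)%Z by rewrite modz_ge0 //; lia.
have : (m %% p%:Z)%Z < p%:Z by rewrite ltz_pmod.
case: (m %% _)%Z => // i lt_i _.
by rewrite (nth_map 0%N) ?size_iota // nth_iota.
Qed.

Lemma configs_of_closed_walk (k : nat) (S : set (hvertex k)) (p : nat) :
  is_LDS (@hadj k) S -> has_period S (2 * p) -> is_closed_walk (configs_of S p).
Proof.
move=> /is_LDS_arcP lds Sp; have p0 : (0 < p)%N by case: Sp => + _; rewrite muln_gt0.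
have sz : size (configs_of S p) = p by rewrite size_map size_iota.
split; first by rewrite sz.
apply/(cycle_nthP _ (finset.set0, finset.set0)) => i; rewrite sz => lt_ip.
(* With indices modulo [p], the closing arc is just the arc from window [p - 1] to window [p]. *)
have nthE n :
    nth (finset.set0, finset.set0) (configs_of S p) (n %% p)%N = window k S n%:Z.
  by rewrite -(nthz_configs_of k S p) // nthz_nat sz.
rewrite nthE -[X in nth _ _ X](modn_small lt_ip) nthE.
by rewrite -addn1 PoszD; exact: lds.
Qed.

Lemma configs_ofK (k : nat) (S : set (hvertex k)) (p : nat) :
  has_period S (2 * p) -> set_of_cycle (configs_of S p) = S.
Proof.
move=> Sp; apply/funext => -[i j]; have [m [c ->]] := col_split j.
have E T : T (i, (c.+1)%:Z + 2 * m) = ((i, c) \in (tracez k T m : {set _})) :> Prop.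
  by apply/propext; rewrite inE; split=> /asboolP.
by rewrite [LHS]E [RHS]E tracez_set_of_cycle nthz_configs_of.
Qed.

(** * Balls and bars *)

Definition colcount (k : nat) (S : set (hvertex k)) (j : int) : nat :=
  #|[set i : 'I_k | `[< S (i, j) >]]%SET|.

(** Counting column by column turns cutting a bar and using periodicity into manipulations of sums;
    [card_bar] relates it to cardinals. *)
Definition barcount (k : nat) (S : set (hvertex k)) (a : int) (n : nat) : nat :=
  (\sum_(t < n) colcount k S (a + t%:Z))%N.

(** The explicit parametrization by a finite type gives both the finiteness of bars and the count of
    their selected vertices. *)
Lemma fset_set_bar (k : nat) (S : set (hvertex k)) (a : int) (n : nat) :
  [set` [fset ((x.1, (a + (x.2 : nat)%:Z)%R) : hvertex k) |
     x : 'I_k * 'I_n in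
       [set y : 'I_k * 'I_n | `[< S (y.1, (a + (y.2 : nat)%:Z)%R) >]]%SET]%fset]
  = @bar k a n `&` S.
Proof.
apply/seteqP; split=> [u /imfsetP[[i t] /=]|[i j]].
  rewrite inE /= => /asboolP Sit ->; split=> //; have := ltn_ord t.
  by rewrite /bar /=; lia.
rewrite /bar /= => -[ja Sij]; have tn : (`|(j - a)|%N < n)%N by lia.
have jE : j = a + (`|(j - a)|%N)%:Z by lia.
apply/imfsetP; exists (i, Ordinal tn); rewrite /= -?jE // inE /= -jE.
exact/asboolP.
Qed.

Lemma finite_bar (k : nat) (a : int) (n : nat) : finite_set (@bar k a n).
Proof. by rewrite -(setIT (bar _ _)) -fset_set_bar; exact: finite_fset. Qed.

Lemma card_bar (k : nat) (S : set (hvertex k)) (a : int) (n : nat) :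
  #|` fset_set (@bar k a n `&` S)| = barcount k S a n.
Proof.
rewrite -fset_set_bar set_fsetK card_imfset => [|[i t] [i' t']] /=; last first.
  by move=> [-> tt']; congr (_, _); apply/val_inj => /=; lia.
rewrite -cardE -sum1_card.
under eq_bigl do rewrite inE.
rewrite -(pair_big_dep xpredT
  (fun i (t : 'I_n) => `[< S (i, a + (t : nat)%:Z) >]) (fun _ _ => 1%N)) /=.
rewrite (exchange_big_dep xpredT) //=; apply: eq_bigr => t _.
by rewrite /colcount -sum1_card; apply: eq_bigl => i; rewrite inE.
Qed.

Lemma barcountT (k : nat) (a : int) (n : nat) : barcount k setT a n = (n * k)%N.
Proof.
rewrite /barcount (eq_bigr (fun=> k)) ?sum_nat_const ?card_ord // => t _.
rewrite /colcount -[RHS]card_ord; apply: eq_card => i; rewrite !inE.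
exact/asboolP.
Qed.

Lemma barcountD (k : nat) (S : set (hvertex k)) (a : int) (m n : nat) :
  barcount k S a (m + n) = (barcount k S a m + barcount k S (a + m%:Z) n)%N.
Proof.
rewrite /barcount big_split_ord /=; congr (_ + _)%N.
by apply: eq_bigr => t _; rewrite PoszD addrA.
Qed.

Lemma walk_cat (V : choiceType) (adj : rel V) (u v w : V) (m n : nat) :
  walk adj u v m -> walk adj v w n -> walk adj u w (m + n).
Proof.
move=> [s [us lu <-]] [t [vt lt <-]]; exists (s ++ t).
by rewrite cat_path us lu last_cat lu size_cat.
Qed.

Lemma walk1 (V : choiceType) (adj : rel V) (u v : V) : adj u v -> walk adj u v 1.
Proof. by move=> uv; exists [:: v]; rewrite /= uv. Qed.

Lemma walk_sym (V : choiceType) (adj : rel V) (u v : V) (n : nat) :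
  symmetric adj -> walk adj u v n -> walk adj v u n.
Proof.
move=> adjC [s [us <- <-]]; exists (rev (belast u s)); split.
- by rewrite rev_path (eq_path (e' := adj)) // => x y; rewrite adjC.
- by case: s us => //= x s _; rewrite rev_cons last_rcons.
- by rewrite size_rev size_belast.
Qed.

Lemma walk_pball (V : choiceType) (adj : rel V) (u v : V) (r n : nat) :
  u <> v -> walk adj u v n -> (n <= r)%N -> pball adj r v u.
Proof.
move=> uv uvn nr; have ex : exists n, `[< walk adj u v n >] by exists n; apply/asboolP.
exists (ex_minn ex); case: ex_minnP => m /asboolP uvm min_m.
split; first by split=> // m' /asboolP; exact: min_m.
rewrite (leq_trans (min_m n _) nr) ?andbT; last exact/asboolP.
(* A walk of length 0 would force [u = v], so the distance is positive. *)
by case: m uvm {min_m} => // -[[|x s] [_ uvE]] // _; exact: uv uvE.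
Qed.

Lemma walk_cols (k : nat) (u v : hvertex k) (n : nat) :
  walk (@hadj k) u v n -> v.2 - n%:Z <= u.2 <= v.2 + n%:Z.
Proof.
move=> [s [+ + <-]]; elim: s u {n} => [|w s IH] u /=; first by move=> _ ->; lia.
by move=> /andP[/hadj_cols uw /IH ws /ws]; move: uw; rewrite /=; lia.
Qed.

Lemma walk_row (k : nat) (i : 'I_k) (j : int) (n : nat) :
  walk (@hadj k) (i, j) (i, j + n%:Z) n.
Proof.
elim: n => [|n IH]; first by exists [::]; rewrite addr0.
rewrite -[X in walk _ _ _ X]addn1; apply: walk_cat IH (walk1 _ _ _ _ _).
by rewrite /hadj /hedge /= eqxx -addn1 PoszD addrA eqxx.
Qed.

(** Each vertex has a vertical edge upwards in its own column or after one step to the right.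
    Climbing a row thus costs at most two steps and one column of drift. *)
Lemma walk_up (k : nat) (d : nat) (i i' : 'I_k) (j : int) : (i' = i + d :> nat)%N ->
  exists j' n, [/\ walk (@hadj k) (i, j) (i', j') n, j <= j' <= j + d%:Z
    & (n <= 2 * d)%N].
Proof.
elim: d i j => [|d IH] i j iE.
  have -> : i' = i by apply/val_inj; rewrite /= iE addn0.
  by exists j, 0%N; split; [exists [::]|lia|].
have lt_ik : (i.+1 < k)%N by have := ltn_ord i'; rewrite iE; lia.
have [j1 [n1 [w1 j1E n1E]]] :
  exists j' n, [/\ walk (@hadj k) (i, j) (Ordinal lt_ik, j') n,
    j <= j' <= j + 1 & (n <= 2)%N].
  have up j' : (2 %| (i.+1)%:Z + j')%Z -> walk (@hadj k) (i, j') (Ordinal lt_ik, j') 1.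
    by move=> ij'; apply: walk1; rewrite /hadj /hedge /= !eqxx ij' /= orbT.
  have [ij|ij] := boolP (2 %| (i.+1)%:Z + j)%Z.
    by exists j, 1%N; split; [exact: up|lia|].
  exists (j + 1), 2%N; split; [|lia|by []].
  by apply: (walk_cat _ _ _ _ _ 1 1 (walk_row _ _ _ 1)); apply: up; lia.
have [|j2 [n2 [w2 j2E n2E]]] := IH (Ordinal lt_ik) j1; first by rewrite /= iE; lia.
by exists j2, (n1 + n2)%N; split; [exact: walk_cat w1 w2|lia|lia].
Qed.

(** Changing rows takes at most 2k steps and drifts by at most k columns, which the horizontal part
    may have to make up: hence 3k. *)
Lemma walk_short (k : nat) (u v : hvertex k) :
  exists2 n, walk (@hadj k) u v n & (n <= `|(u.2 - v.2)|%N + 3 * k)%N.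
Proof.
wlog uv : u v / (u.1 <= v.1)%N.
  move=> H; have [uv|vu] := leqP u.1 v.1; first exact: H.
  have [n w nE] := H v u (ltnW vu); exists n; last by lia.
  exact/walk_sym/w/hadj_sym.
move: u v uv => [i j] [i' j'] /= ii'.
have [|j1 [n1 [w1 j1E n1E]]] := walk_up k (i' - i) i i' j; first by lia.
have ltk := ltn_ord i'.
exists (n1 + `|(j1 - j')|)%N; last by lia.
apply: walk_cat w1 _; have [le|lt] := leP j1 j'.
  have := walk_row k i' j1 `|(j1 - j')|%N.
  by have -> : j1 + `|(j1 - j')|%N%:Z = j' by lia.
apply: walk_sym; first exact: hadj_sym.
have := walk_row k i' j' `|(j1 - j')|%N.
by have -> : j' + `|(j1 - j')|%N%:Z = j1 by lia.
Qed.

Lemma pball_sub_bar (k : nat) (v : hvertex k) (r : nat) :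
  pball (@hadj k) r v `<=` @bar k (v.2 - r%:Z) (2 * r + 1).
Proof.
move=> u [n [[/walk_cols uvn _] nr]]; move: uvn; rewrite /bar /=; lia.
Qed.

Lemma bar_sub_pball (k : nat) (v : hvertex k) (r : nat) :
  @bar k (v.2 - r%:Z) (2 * r + 1) `<=` v |` pball (@hadj k) (r + 3 * k) v.
Proof.
move=> u; rewrite /bar /= => uv; have [->|neq] := pselect (u = v); first by left.
right; have [n w nE] := walk_short k u v; apply: (walk_pball _ _ _ _ _ n) => //.
by move: nE; rewrite /= in uv *; lia.
Qed.

Lemma finite_pball (k : nat) (v : hvertex k) (r : nat) :
  finite_set (pball (@hadj k) r v).
Proof. exact: sub_finite_set (pball_sub_bar k v r) (finite_bar _ _ _). Qed.

Lemma card_pball_le (k : nat) (S : set (hvertex k)) (v : hvertex k) (r : nat) :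
  (#|` fset_set (pball (@hadj k) r v `&` S)| <=
   barcount k S (v.2 - r%:Z) (2 * r + 1))%N.
Proof.
rewrite -card_bar; apply: fsubset_leq_card.
rewrite -fset_set_sub; first by apply: setSI; exact: pball_sub_bar.
  exact/finite_setIl/finite_pball.
exact/finite_setIl/finite_bar.
Qed.

Lemma card_pball_ge (k : nat) (S : set (hvertex k)) (v : hvertex k) (r : nat) :
  (barcount k S (v.2 - r%:Z) (2 * r + 1) <=
   (#|` fset_set (pball (@hadj k) (r + 3 * k) v `&` S)|).+1)%N.
Proof.
have fP := finite_pball k v (r + 3 * k).
rewrite -card_bar.
(* The centre [v] is the only vertex of the bar that the punctured ball can miss, which accounts for
   the successor. *)
apply: (@leq_trans #|` fset_set (v |` (pball (@hadj k) (r + 3 * k) v `&` S))|).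
  apply: fsubset_leq_card; rewrite -fset_set_sub.
  - by move=> u [/bar_sub_pball[->|up] Su]; [left|right].
  - exact/finite_setIl/finite_bar.
  - by rewrite finite_setU; split; [exact: finite_set1|exact/finite_setIl].
rewrite fset_setU1; last exact/finite_setIl.
by rewrite cardfsU1 -[X in (_ <= X)%N]add1n leq_add2r leq_b1.
Qed.

(** * Densities *)

(** The limit superior is an infimum of suprema over neighbourhoods of infinity: one tail suffices
    here, while the lower bound must treat every neighbourhood. *)
Lemma limn_esup_le (R : realType) (u : nat -> R) (q : R) :
  (forall e, 0 < e -> exists N, forall n, (N <= n)%N -> u n <= q + e) ->
  (limn_esup (EFin \o u) <= q%:E)%E.
Proof.
move=> uq; apply/lee_addgt0Pr => e /uq[N uN].
apply: ereal_inf_le; exists (ereal_sup ((EFin \o u) @` [set n | (N <= n)%N])).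
  by exists [set n | (N <= n)%N] => //; exists N.
by apply: ge_ereal_sup => _ [n /= Nn <-]; rewrite lee_fin uN.
Qed.

Lemma limn_esup_ge (R : realType) (u : nat -> R) (q : R) :
  (forall e, 0 < e -> exists N, forall n, (N <= n)%N -> q - e <= u n) ->
  (q%:E <= limn_esup (EFin \o u))%E.
Proof.
move=> uq; apply: le_ereal_inf_tmp => _ [V [M _ MV] <-].
apply/lee_subgt0Pr => e /uq[N uN].
apply: (@le_trans _ _ (u (maxn M N))%:E).
  by rewrite -EFinB lee_fin uN // leq_maxr.
by apply: ereal_sup_ubound; exists (maxn M N) => //; apply: MV; rewrite /= leq_maxl.
Qed.

Lemma pball_lower (k : nat) (v : hvertex k) (r : nat) :
  (k * (2 * r + 1) <= (#|` fset_set (pball (@hadj k) (r + 3 * k) v)|).+1)%N.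
Proof. by have := card_pball_ge k setT v r; rewrite barcountT setIT mulnC. Qed.

Lemma pball_upper (k : nat) (v : hvertex k) (r : nat) :
  (#|` fset_set (pball (@hadj k) r v)| <= k * (2 * r + 1))%N.
Proof. by have := card_pball_le k setT v r; rewrite barcountT setIT mulnC. Qed.

(** Balls grow at least linearly with the radius, so a bounded error in a count is eventually
    negligible against their size. *)
Lemma ratio_threshold (R : realType) (k : nat) (v : hvertex k) (K e : R) :
  (0 < k)%N -> 0 < e -> exists N, forall n,
  (N <= n)%N -> exists r, [/\ n = (r + 3 * k)%N,
   0 < (#|` fset_set (pball (@hadj k) n v)|)%:R :> R &
   K <= e * (#|` fset_set (pball (@hadj k) n v)|)%:R].
Proof.
move=> k0 e0; exists ((Num.truncn (`|K| / e)).+1 + 3 * k)%N => n Nn.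
have nE : n = (n - 3 * k + 3 * k)%N by lia.
set r := (n - 3 * k)%N in nE; have rK : (Num.truncn (`|K| / e) < r)%N by lia.
have := pball_lower k v r; rewrite -nE; set P := #|` _| => lowP.
have rP : (r <= P)%N by rewrite -ltnS (leq_trans _ lowP) //; nia.
exists r; split=> //.
  by rewrite ltr0n; apply: leq_trans rP; apply: leq_ltn_trans rK.
rewrite (le_trans (ler_norm _)) // mulrC -ler_pdivrMr //.
by rewrite (le_trans (ltW (truncnS_gt _))) // ler_nat (leq_trans rK).
Qed.

Lemma vdensity_le (R : realType) (k : nat) (S : set (hvertex k)) (v : hvertex k)
    (rho K : R) : (0 < k)%N -> 0 <= rho ->
  (forall a n, (barcount k S a n)%:R <= rho * n%:R + K) ->
  (vdensity R (@hadj k) S v <= (rho / k%:R)%:E)%E.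
Proof.
move=> k0 rho0 bcS; have kR : 0 < k%:R :> R by rewrite ltr0n.
set q := rho / k%:R; apply: limn_esup_le => e e0.
(* The bar around the ball has [2n + 1 = (2r + 1) + 6k] columns. As [rho = q k], the excess columns
   cost [6 q k^2], the missing centre costs [q], and [K] is the given error. *)
have [N HN] := ratio_threshold R k v (q * (1 + 6 * k%:R ^+ 2) + K) e k0 e0.
exists N => n /HN[r [nE P0 KP]]; rewrite /card_ratio ler_pdivrMr //.
have := card_pball_le k S v n; have := pball_lower k v r; rewrite -nE.
move: P0 KP; set P := #|` _|; set Q := #|` _| => P0 KP.
rewrite -!(ler_nat R) => lowP upQ.
apply: (le_trans upQ); apply: (le_trans (bcS _ _)).
have rhoE : rho = q * k%:R by rewrite /q divfK // gt_eqF.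
have q0 : 0 <= q by rewrite divr_ge0 // ltW.
have := ler_wpM2l q0 lowP; rewrite nE rhoE.
rewrite -[in P.+1]addn1 !(natrD, natrM) => lowP'; nra.
Qed.

Lemma vdensity_ge (R : realType) (k : nat) (S : set (hvertex k)) (v : hvertex k)
    (rho K : R) : (0 < k)%N -> 0 <= rho ->
  (forall a n, rho * n%:R - K <= (barcount k S a n)%:R) ->
  ((rho / k%:R)%:E <= vdensity R (@hadj k) S v)%E.
Proof.
move=> k0 rho0 bcS; have kR : 0 < k%:R :> R by rewrite ltr0n.
set q := rho / k%:R; apply: limn_esup_ge => e e0.
(* The inner bar lacks [6k] columns, costing [6 q k^2]; the extra 1 is the centre, possibly counted
   in the bar. *)
have [N HN] := ratio_threshold R k v (q * (6 * k%:R ^+ 2) + K + 1) e k0 e0.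
exists N => n /HN[r [nE P0 KP]]; rewrite /card_ratio ler_pdivlMr //.
have := card_pball_ge k S v r; have := pball_upper k v n; rewrite -nE.
move: P0 KP; set P := #|` _|; set Q := #|` _| => P0 KP.
rewrite -!(ler_nat R) => upP lowQ.
have rhoE : rho = q * k%:R by rewrite /q divfK // gt_eqF.
have q0 : 0 <= q by rewrite divr_ge0 // ltW.
have := le_trans (bcS _ _) lowQ; have := ler_wpM2l q0 upP; rewrite nE rhoE.
rewrite -[in Q.+1]addn1 !(natrD, natrM) => ? ?; nra.
Qed.

(** Moving the window by one trades [f a] for the equal value [f (a + p)], so the sum has period 1
    in [a] and is constant. *)
Lemma sum_window_shift (f : int -> nat) (p : nat) (a : int) :
  (forall j, f (j + p%:Z) = f j) ->
  (\sum_(t < p) f (a + t%:Z)%R = \sum_(t < p) f (1 + t%:Z)%R)%N.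
Proof.
move=> fp; pose F a := (\sum_(t < p) f (a + t%:Z)%R)%N.
have F1 b : F (b + 1) = F b.
  rewrite /F; case: (p) fp => [|n] fn; first by rewrite !big_ord0.
  rewrite big_ord_recr big_ord_recl /= addr0 addnC; congr (_ + _)%N.
    by rewrite -[RHS]fn; congr f; lia.
  by apply: eq_bigr => t _; congr f; rewrite /bump /=; lia.
by have := periodicz _ F 1 F1 1 (a - 1); rewrite mul1r addrC subrK.
Qed.

(** The sum differs from [n W / p] by at most [W], stated without division. Whole periods are
    stripped off, each contributing exactly [W]; a shorter window sums to at most [W]. *)
Lemma periodic_sum_bound (f : int -> nat) (p n : nat) (a : int) : (0 < p)%N ->
  (forall j, f (j + p%:Z) = f j) ->
  let W := (\sum_(t < p) f (1 + t%:Z)%R)%N in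
  (n * W <= p * (\sum_(t < n) f (a + t%:Z)%R) + p * W)%N /\
  (p * (\sum_(t < n) f (a + t%:Z)%R) <= n * W + p * W)%N.
Proof.
move=> p0 fp W; elim/ltn_ind: n a => n IH a.
have [lt_np|le_pn] := ltnP n p.
  have : (\sum_(t < n) f (a + t%:Z)%R <= W)%N.
    rewrite /W -(sum_window_shift f p a fp) -(subnKC (ltnW lt_np)) big_split_ord /=.
    exact: leq_addr.
  by move=> le_W; nia.
have [|IH1 IH2] := IH (n - p)%N _ (a + p%:Z); first by lia.
have -> : (\sum_(t < n) f (a + t%:Z)%R = W + \sum_(t < n - p) f (a + p%:Z + t%:Z)%R)%N.
  rewrite -[in LHS](subnKC le_pn) big_split_ord /= sum_window_shift //.
  by congr (_ + _)%N; apply: eq_bigr => t _; congr f; lia.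
by nia.
Qed.

Lemma card_tracez (k : nat) (S : set (hvertex k)) (m : int) :
  #|tracez k S m| = (colcount k S (1 + 2 * m)%R + colcount k S (2 + 2 * m)%R)%N.
Proof.
rewrite -sum1_card.
under eq_bigl do rewrite inE.
rewrite -(pair_big_dep xpredT
  (fun i (c : 'I_2) => `[< S (i, (c.+1)%:Z + 2 * m) >]) (fun _ _ => 1%N)) /=.
rewrite (exchange_big_dep xpredT) //= big_ord_recl big_ord_recl big_ord0 addn0 /=.
by congr (_ + _)%N; rewrite /colcount -sum1_card; apply: eq_bigl => i; rewrite inE.
Qed.

Lemma barcount_even (k : nat) (S : set (hvertex k)) (m : int) (n : nat) :
  barcount k S (1 + 2 * m) (2 * n) = (\sum_(t < n) #|tracez k S (m + t%:Z)%R|)%N.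
Proof.
elim: n => [|n IH]; first by rewrite muln0 /barcount !big_ord0.
rewrite big_ord_recr -IH /= mulnSr barcountD; congr (_ + _)%N.
rewrite card_tracez /barcount 2!big_ord_recr big_ord0 /= add0n /=.
by congr (_ + _)%N; congr colcount; rewrite /=; lia.
Qed.

(** * Minimum mean cycles *)

Lemma colcount_periodic (k : nat) (S : set (hvertex k)) (p : nat) (j : int) :
  has_period S p -> colcount k S (j + p%:Z) = colcount k S j.
Proof.
move=> [_ Sp]; apply: eq_card => i; rewrite !inE.
by apply: asbool_equiv_eq; rewrite -Sp.
Qed.

(* An arc's weight depends only on its target, so summing over the arcs of a
   cycle amounts to summing over its vertices. *)
Lemma cycle_weightE (k : nat) (C : seq (config k)) :
  cycle_weight C = (\sum_(B <- C) #|(B.2 : {set 'I_k * 'I_2})|)%N.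
Proof.
rewrite /cycle_weight /arc_weight -(perm_big _ (permEl (perm_rot 1 C))) /=.
rewrite -[in RHS](unzip2_zip (s := C) (t := rot 1 C)) ?size_rot //.
by rewrite big_map.
Qed.

Lemma cycle_weight_barcount (k : nat) (C : seq (config k)) :
  is_closed_walk C ->
  cycle_weight C = barcount k (set_of_cycle C) 1 (2 * size C).
Proof.
move=> cw; have [C0 _] := cw.
(* Arc weights count second components, so the sum naturally starts at column 3; periodicity allows
   a start at column 1. *)
rewrite /barcount -(sum_window_shift _ _ (1 + 2 * 1)); last first.
  by move=> j; apply/colcount_periodic/set_of_cycle_period.
rewrite -/(barcount k (set_of_cycle C) (1 + 2 * 1) (2 * size C)) barcount_even.
rewrite cycle_weightE (big_nth (finset.set0, finset.set0)) big_mkord.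
apply: eq_bigr => t _; rewrite -[in LHS](modn_small (ltn_ord t)) -nthz_nat.
by rewrite -window_set_of_cycle //= addrC.
Qed.

Lemma density_const (R : realType) (k : nat) (S : set (hvertex k)) (x : \bar R) :
  (0 < k)%N -> (forall v, vdensity R (@hadj k) S v = x) -> density R (@hadj k) S = x.
Proof.
move=> k0 Sx; apply/le_anti/andP; split.
  by apply: ereal_inf_lbound; exists (Ordinal k0, 0).
by apply: le_ereal_inf_tmp => _ [v _ <-]; rewrite Sx.
Qed.

Lemma density_set_of_cycle (R : realType) (k : nat) (C : seq (config k)) :
  (0 < k)%N -> is_closed_walk C ->
  density R (@hadj k) (set_of_cycle C) = (cycle_mean R C / (2 * k%:R))%:E.
Proof.
move=> k0 cw; have [C0 _] := cw; apply: density_const => // v.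
set S := set_of_cycle C; set p := size C in C0 *; pose W := cycle_weight C.
have p2 : (0 < 2 * p)%N by rewrite muln_gt0.
have pR : 0 < (2 * p)%N%:R :> R by rewrite ltr0n.
have bd a n := periodic_sum_bound (colcount k S) (2 * p) n a p2
  (fun j => colcount_periodic k S (2 * p) j (set_of_cycle_period k C C0)).
have WE : W = barcount k S 1 (2 * p) by exact: cycle_weight_barcount.
(* [W / (2p)] is the average number of selected vertices per column, the [rho] of the two density
   bounds. *)
have -> : cycle_mean R C / (2 * k%:R) = W%:R / (2 * p)%N%:R / k%:R.
  by rewrite /cycle_mean natrM -/p -/W -!mulrA -!invfM; congr (_ / _); ring.
have rho0 : 0 <= W%:R / (2 * p)%N%:R :> R by rewrite divr_ge0.
have rhoE n : (2 * p)%N%:R * (W%:R / (2 * p)%N%:R * n%:R) = (n * W)%N%:R :> R.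
  by rewrite mulrA (mulrC (2 * p)%N%:R) divfK ?gt_eqF // mulrC natrM.
apply/le_anti/andP; split.
  apply: (vdensity_le _ _ _ _ _ W%:R) => // a n; have [_] := bd a n.
  rewrite -/(barcount k S a n) -/(barcount k S 1 (2 * p)) -WE -(ler_nat R).
  by move=> bdW; rewrite -(ler_pM2l pR) mulrDr rhoE -!natrM -natrD.
apply: (vdensity_ge _ _ _ _ _ W%:R) => // a n; have [+ _] := bd a n.
rewrite -/(barcount k S a n) -/(barcount k S 1 (2 * p)) -WE -(ler_nat R).
by move=> bdW; rewrite -(ler_pM2l pR) mulrBr rhoE -!natrM lerBlDr -natrD.
Qed.

Lemma barcount_LDS_ge (R : realType) (k : nat) (C : seq (config k))
    (S : set (hvertex k)) (a : int) (n : nat) :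
  is_min_mean_cycle R C -> is_LDS (@hadj k) S ->
  cycle_mean R C / 2 * n%:R - cycle_mean R C * (1 + #|{: config k}|%:R) <=
    (barcount k S a n)%:R.
Proof.
move=> [_ minC] /is_LDS_arcP arcS; set mu := cycle_mean R C.
have mu0 : 0 <= mu by rewrite divr_ge0.
(* Windows begin in odd columns, so at most one column is dropped on the left. *)
have [m [d [d1 aE]]] : exists (m : int) (d : nat), (d <= 1)%N /\ a + d%:Z = 1 + 2 * m.
  have [m [c ->]] := col_split a; exists (m + (c : nat)%:Z), c.
  by have := ltn_ord c; split; lia.
pose n' := (n.-1)./2.
have le_n' : (barcount k S (1 + 2 * m) (2 * n') <= barcount k S a n)%N.
  have [n00|n0] := posnP n; first by rewrite /n' n00 muln0 /barcount !big_ord0.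
  have -> : n = (d + (2 * n' + (n - d - 2 * n')))%N by rewrite /n'; lia.
  by rewrite !barcountD aE; lia.
rewrite -(ler_nat R) in le_n'; apply: le_trans le_n'.
rewrite barcount_even.
(* The walk starts one block early because the weight of a window is that of its second block. *)
pose t := [seq window k S (m - 1 + i%:Z) | i <- iota 0 n'].
have szt : size t = n' by rewrite size_map size_iota.
have -> : (\sum_(i < n') #|tracez k S (m + i%:Z)%R| =
    \sum_(B <- t) #|(B.2 : {set 'I_k * 'I_2})|)%N.
  rewrite /t big_map -(big_mkord xpredT (fun i => #|tracez k S (m + i%:Z)%R|)).
  rewrite /index_iota subn0; apply: eq_bigr => i _.
  by rewrite /window /=; congr #|tracez k S _|; lia.
have st : sorted (@Defs.arc k) t.
  apply/(sortedP (window k S 0)) => i; rewrite szt => lt_i.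
  rewrite !(nth_map 0%N) ?size_iota ?(ltnW lt_i) // !nth_iota ?(ltnW lt_i) // !add0n.
  have -> : m - 1 + i.+1%:Z = m - 1 + i%:Z + 1 by lia.
  exact: arcS.
apply: le_trans (walk_weight_ge R _ _
  (fun B => #|(B.2 : {set 'I_k * 'I_2})|) mu t mu0 _ st).
  (* At most two columns were dropped, costing [mu]; this is the 1 next to the number of
     configurations. *)
  have : n%:R <= 2 * n'%:R + 2 :> R by rewrite -natrM -natrD ler_nat /n'; lia.
  by rewrite szt => n2; nra.
move=> c c0 cc uc; rewrite -cycle_weightE -ler_pdivlMr ?ltr0n //.
exact: minC.
Qed.

Lemma density_LDS_ge (R : realType) (k : nat) (C : seq (config k))
    (S : set (hvertex k)) : (0 < k)%N ->
  is_min_mean_cycle R C -> is_LDS (@hadj k) S ->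
  ((cycle_mean R C / (2 * k%:R))%:E <= density R (@hadj k) S)%E.
Proof.
move=> k0 minC lds; apply: le_ereal_inf_tmp => _ [v _ <-].
rewrite invfM mulrA; apply: vdensity_ge => //; first by rewrite !divr_ge0.
by move=> a n; apply: barcount_LDS_ge.
Qed.

Lemma is_LDS_setT (k : nat) : is_LDS (@hadj k) setT.
Proof. by split=> [v []|u v _ []]. Qed.

Lemma has_period_setT (k p : nat) : (0 < p)%N -> has_period (@setT (hvertex k)) p.
Proof. by []. Qed.

(** The full vertex set yields a loop, so the digraph always has a cycle and the minimum below is
    over a nonempty family. *)
Lemma is_cycle_setT (k : nat) : is_cycle (configs_of (@setT (hvertex k)) 1).
Proof.
by split=> //; apply: configs_of_closed_walk; [exact: is_LDS_setT|exact: has_period_setT].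
Qed.

(** A cycle has no repetition, so its length is at most the number of configurations, and all cycles
    live in the finite type [T]. *)
Lemma min_mean_cycle_exists (R : realType) (k : nat) :
  exists C : seq (config k), is_min_mean_cycle R C.
Proof.
pose T := {n : 'I_(#|{: config k}|.+1) & n.-tuple (config k)}.
have inT (C : seq (config k)) : is_cycle C -> exists x : T, tagged x = C :> seq _.
  move=> [_ uC]; have lt_C : (size C < #|{: config k}|.+1)%N.
    by rewrite ltnS -(card_uniqP uC) max_card.
  by exists (Tagged (fun n : 'I__ => n.-tuple (config k))
    (in_tuple C : (Ordinal lt_C).-tuple _)).
have [x0 x0E] := inT _ (is_cycle_setT k).
have Px0 : `[< is_cycle (tagged x0 : seq (config k)) >].
  by apply/asboolP; rewrite x0E; exact: is_cycle_setT.
case: (@arg_minP _ _ _ x0 (fun x : T => `[< is_cycle (tagged x : seq (config k)) >])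
  (fun x : T => cycle_mean R (tagged x : seq (config k))) Px0) => x /asboolP cx minx.
exists (tagged x); split=> // C' cC'; have [y yE] := inT _ cC'.
by rewrite -yE; apply: minx; rewrite yE; apply/asboolP.
Qed.

Theorem theorem3 (R : realType) (k : nat) (hk : (2 <= k)%N) :
  (* (a), the equivalence *)
  ((exists (p : nat) (C : seq (config k)),
      [/\ (1 <= p)%N, is_cycle C & size C = p]) <->
   (exists (p : nat) (S : set (hvertex k)),
      [/\ (1 <= p)%N, is_LDS (@hadj k) S & has_period S (2 * p)])) /\
  (* (a), the correspondence for each length: cycles of length p correspond to
     the LDSs of period 2p whose p windows are distinct, and closed walks of
     length p to all the LDSs of period 2p *)
  (forall (p : nat) (S : set (hvertex k)), (1 <= p)%N ->
     ((exists C : seq (config k),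
         [/\ is_cycle C, size C = p & S = set_of_cycle C]) <->
      [/\ is_LDS (@hadj k) S, has_period S (2 * p) & uniq (configs_of S p)]) /\
     ((exists C : seq (config k),
         [/\ is_closed_walk C, size C = p & S = set_of_cycle C]) <->
      (is_LDS (@hadj k) S /\ has_period S (2 * p)))) /\
  (* (a), the density, for closed walks and in particular for cycles *)
  (forall C : seq (config k), is_closed_walk C ->
     density R (@hadj k) (set_of_cycle C)
       = (cycle_mean R C / (2 * k%:R))%:E) /\
  (* (a), minimum mean cycles yield minimum-density periodic LDSs *)
  (forall C : seq (config k), is_min_mean_cycle R C ->
     [/\ is_LDS (@hadj k) (set_of_cycle C),
         is_periodic (set_of_cycle C)
       & forall S : set (hvertex k), is_LDS (@hadj k) S -> is_periodic S ->
           (density R (@hadj k) (set_of_cycle C) <= density R (@hadj k) S)%E])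
  /\
  (* (b) *)
  (exists S : set (hvertex k),
     [/\ is_LDS (@hadj k) S, is_periodic S
       & density R (@hadj k) S = min_density R (@hadj k)]) /\
  (exists C : seq (config k), is_min_mean_cycle R C) /\
  (forall C : seq (config k), is_min_mean_cycle R C ->
     min_density R (@hadj k) = (cycle_mean R C / (2 * k%:R))%:E).
Proof.
have k0 : (0 < k)%N by exact: ltnW.
have min_densityE (C : seq (config k)) : is_min_mean_cycle R C ->
    min_density R (@hadj k) = (cycle_mean R C / (2 * k%:R))%:E.
  move=> minC; have [[cw _] _] := minC; apply/le_anti/andP; split.
    rewrite -(density_set_of_cycle R k C k0 cw); apply: ereal_inf_lbound.
    by exists (set_of_cycle C) => //; exact: set_of_cycle_LDS.
  by apply: le_ereal_inf_tmp => _ [S lds <-]; exact: density_LDS_ge.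
split.
  (* Both sides hold outright, witnessed by the full vertex set and its loop. *)
  split=> _; first by exists 1%N, setT; split=> //; exact: is_LDS_setT.
  by exists 1%N, (configs_of (@setT (hvertex k)) 1); split=> //; exact: is_cycle_setT.
split.
  move=> p S p0; split; split.
  - move=> [C [[cw uC] <- ->]]; split; first exact: set_of_cycle_LDS.
      by apply: set_of_cycle_period; case: cw.
    by rewrite set_of_cycleK.
  - move=> [lds Sp uS]; exists (configs_of S p); split.
    + by split=> //; exact: configs_of_closed_walk.
    + by rewrite size_map size_iota.
    + by rewrite configs_ofK.
  - move=> [C [cw <- ->]]; split; first exact: set_of_cycle_LDS.
    by apply: set_of_cycle_period; case: cw.
  - move=> [lds Sp]; exists (configs_of S p); split.
    + exact: configs_of_closed_walk.
    + by rewrite size_map size_iota.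
    + by rewrite configs_ofK.
split; first by move=> C; exact: density_set_of_cycle.
have periodicC (C : seq (config k)) : is_closed_walk C -> is_periodic (set_of_cycle C).
  by move=> [C0 _]; exists (2 * size C)%N; exact: set_of_cycle_period.
split.
  move=> C minC; have [[cw _] _] := minC; split.
  - exact: set_of_cycle_LDS.
  - exact: periodicC.
  - by move=> S lds _; rewrite density_set_of_cycle //; exact: density_LDS_ge.
split; last by split=> //; exact: min_mean_cycle_exists.
(* The periodic optimum is constructed: the set of a minimum mean cycle attains the lower bound
   valid for all LDSs. *)
have [C minC] := min_mean_cycle_exists R k; have [[cw _] _] := minC.
exists (set_of_cycle C); split; [exact: set_of_cycle_LDS|exact: periodicC|].
by rewrite (min_densityE _ minC) density_set_of_cycle.
Qed.
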